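(* Let $A$ be a commutative $\Omega$-operated $\mathbf{k}$-algebra that is an $E$-algebra for a $\mathbf{k}$-submodule $E\subseteq\mathbf{k}\mathfrak{C}_\Omega(Y)$. Then there is an isomorphism of categories $\mathbf{Mod}_A(\Omega|E)\cong\mathbf{Mod}_{A[\Omega|E]}$ between the category of $E$-modules over $A$ and the category of left modules over the ring $A[\Omega|E]$ of $E$-operators.
   Context: $\mathbf{k}$ is a commutative ring; rings and algebras are associative and unital; modules are left modules. An $\Omega$-operated algebra is a $\mathbf{k}$-algebra $A$ with $\mathbf{k}$-linear maps $P_\omega\colon A\to A$ ($\omega\in\Omega$). Laws. Let $Y=\{y_0,y_1,y_2,\dots\}$. With $C(Z)$ the free commutative monoid on $Z$, put $\mathfrak{C}_{\Omega,0}(Y)=C(Y)$, $\mathfrak{C}_{\Omega,n}(Y)=C\big(Y\uplus\biguplus_{\omega}\lfloor\mathfrak{C}_{\Omega,n-1}(Y)\rfloor_\omega\big)$ (with $\lfloor S\rfloor_\omega=\{\lfloor u\rfloor_\omega\mid u\in S\}$ a disjoint copy of $S$) and $\mathfrak{C}_\Omega(Y)=\bigcup_n\mathfrak{C}_{\Omega,n}(Y)$. Then $\mathbf{k}\mathfrak{C}_\Omega(Y)$ with $u\mapsto\lfloor u\rfloor_\omega$ is the free commutative $\Omega$-operated algebra on $Y$. $A$ is an $E$-algebra if every $l\in E$ vanishes in $A$ under every assignment $Y\to A$ (interpreting $\lfloor\ \rfloor_\omega$ as $P_\omega$). It is assumed that $E$ is spanned by homogeneous multilinear elements (each variable occurring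 in such an element occurs exactly once in each of its monomials), none of total degree $0$; by renaming, a basis element of total degree $k+1$ is written in the variables $y_0,\dots,y_k$. Such basis elements are called the standard laws. Relators. The ring of free operators is the free product $A[\Omega]:=A*\mathbf{k}\langle\Omega\rangle$. Let $Y'=Y\setminus\{y_0\}$ and $\mathfrak{a}\colon Y'\to A$ an assignment; let $\bar{\mathfrak a}$ be its extension to bracket words in $Y'$, replacing $y$ by $\mathfrak{a}(y)$ and $\lfloor\ \rfloor_\omega$ by $P_\omega$. For a standard law $l$ the induced relator $[l]_{\mathfrak a}\in A[\Omega]$ is $\mathbf{k}$-linear in $l$ and, for a multilinear monomial $l$ containing $y_0$, recursively defined by: if $l=t\,y_0$ with $t$ a bracket word in $Y'$, then $[l]_{\mathfrak a}=\bar{\mathfrak a}(t)$; if $l=t\lfloor l'\rfloor_\omega$ with $t$ a bracket word in $Y'$ and $y_0$ occurring in $l'$, then $[l]_{\mathfrak a}=\bar{\mathfrak a}(t)\,\omega\,[l']_{\mathfrak a}$. Let $[E]\subset A[\Omega]$ be the two-sided ideal generated by all $[l]_{\mathfrak a}$, for all standard laws $l\in E$ and assignments $\mathfrak a\colon Y'\to A$. The ring of $E$-operators is $A[\Omega|E]:=A[\Omega]/[E]$. Modules. An $\Omega$-operated module over $A$ is an $A$-module $M$ with $\mathbf{k}$-linear operators $p_\omega\colon M\to M$ ($\omega\in\Omega$), with no further restriction; morphisms are $A$-linear maps $\phi$ with $\phi\circ p_\omega=p'_\omega\circ\phi$ for all $\omega$. Every such $M$ is an $A[\Omega]$-module via $\omega\cdot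 m=p_\omega(m)$ and $a\cdot m=am$. $M$ is an $E$-module if $L\cdot m=0$ for all $L\in[E]$ and $m\in M$; $\mathbf{Mod}_A(\Omega|E)$ is the full subcategory of $\Omega$-operated modules over $A$ formed by the $E$-modules. *)

(* Defs.v *)
From HB Require Import structures.
From mathcomp Require Import all_boot all_order all_algebra generic_quotient.
From mathcomp Require Import finmap monalg zify.
From mathcomp Require Import boolp classical_sets.

Set Implicit Arguments.
Unset Strict Implicit.
Unset Printing Implicit Defensive.

Import GRing.Theory.
Local Open Scope ring_scope.
Local Open Scope quotient_scope.
Local Open Scope classical_set_scope.

(* An associative unital k-algebra, as a ring with a central structure morphism
   from k; MathComp's [algType] and [comAlgType] exclude the zero ring. *)
Record algebra (k : comPzRingType) := Algebra {
  alg_ring :> pzRingType;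
  alg_str : {rmorphism k -> alg_ring};
  alg_central : forall (c : k) (x : alg_ring), alg_str c * x = x * alg_str c
}.
Arguments alg_str {k} a.
Arguments alg_central {k} a.

Definition com_algebra (k A : comPzRingType) (iota : {rmorphism k -> A}) :
    algebra k :=
  @Algebra k A iota (fun c x => mulrC (iota c) x).

Definition alg_morphism (k : comPzRingType) (A B : algebra k) (f : A -> B) :=
  [/\ nmod_morphism f, monoid_morphism f
    & forall c, f (alg_str A c) = alg_str B c].

(* Restriction of scalars along k -> A. *)
Definition restr (k A : pzRingType) (iota : {rmorphism k -> A})
  (M : lmodType A) : Type := M.

Section Restriction.
Variables (k A : pzRingType) (iota : {rmorphism k -> A}) (M : lmodType A).
Local Notation V := (restr iota M).

HB.instance Definition _ := GRing.Zmodule.copy V M.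

Definition restr_scale (c : k) (x : V) : V := iota c *: (x : M).

Lemma restr_scaleA a b v :
  restr_scale a (restr_scale b v) = restr_scale (a * b) v.
Proof. by rewrite /restr_scale scalerA rmorphM. Qed.
Lemma restr_scale1 : left_id 1 restr_scale.
Proof. by move=> v; rewrite /restr_scale rmorph1 scale1r. Qed.
Lemma restr_scaleDr : right_distributive restr_scale +%R.
Proof. by move=> c u v; rewrite /restr_scale scalerDr. Qed.
Lemma restr_scaleDl v : {morph restr_scale^~ v : a b / a + b}.
Proof. by move=> a b; rewrite /restr_scale rmorphD scalerDl. Qed.

HB.instance Definition _ := GRing.Zmodule_isLmodule.Build k V
  restr_scaleA restr_scale1 restr_scaleDr restr_scaleDl.
End Restriction.

Section Endomorphisms.
Variables (k : comPzRingType) (V : lmodType k).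

Definition endo : Type := {linear V -> V}.
HB.instance Definition _ := gen_eqMixin endo.
HB.instance Definition _ := gen_choiceMixin endo.

Definition endo_fun (f : endo) : V -> V := f.

Lemma endo_ext (f g : endo) : endo_fun f =1 endo_fun g -> f = g.
Proof.
rewrite /endo_fun; case: f => [f [[f1] [f2]]]; case: g => [g [[g1] [g2]]] /= /funext fg.
case: _ / fg in g1 g2 *.
by rewrite (Prop_irrelevance f1 g1) (Prop_irrelevance f2 g2).
Qed.

Definition endo_zero : endo := (\0 : {linear V -> V}).
Definition endo_one : endo := (idfun : {linear V -> V}).
Definition endo_opp (f : {linear V -> V}) : endo := (-1) \*: f.
Definition endo_add (f g : {linear V -> V}) : endo := f \+ g.
Definition endo_mul (f g : {linear V -> V}) : endo := f \o g.
Definition endo_cst (c : k) : endo := c \*: (idfun : {linear V -> V}).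

Lemma endo_addA : associative (endo_add : endo -> endo -> endo).
Proof. by move=> f g h; apply: endo_ext => v; apply: addrA. Qed.
Lemma endo_addC : commutative (endo_add : endo -> endo -> endo).
Proof. by move=> f g; apply: endo_ext => v; apply: addrC. Qed.
Lemma endo_add0 : left_id endo_zero endo_add.
Proof. by move=> f; apply: endo_ext => v; apply: add0r. Qed.
Lemma endo_addN : left_inverse endo_zero endo_opp endo_add.
Proof.
by move=> f; apply: endo_ext => v; rewrite /endo_fun /= scaleN1r addNr.
Qed.

HB.instance Definition _ := GRing.isZmodule.Build endo
  endo_addA endo_addC endo_add0 endo_addN.

Lemma endo_mulA : associative (endo_mul : endo -> endo -> endo).
Proof. by move=> f g h; apply: endo_ext. Qed.
Lemma endo_mul1l : left_id endo_one endo_mul.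
Proof. by move=> f; apply: endo_ext. Qed.
Lemma endo_mul1r : right_id endo_one endo_mul.
Proof. by move=> f; apply: endo_ext. Qed.
Lemma endo_mulDl : left_distributive (endo_mul : endo -> endo -> endo) endo_add.
Proof. by move=> f g h; apply: endo_ext. Qed.
Lemma endo_mulDr : right_distributive (endo_mul : endo -> endo -> endo) endo_add.
Proof. by move=> f g h; apply: endo_ext => v; apply: raddfD. Qed.

HB.instance Definition _ := GRing.Zmodule_isPzRing.Build endo
  endo_mulA endo_mul1l endo_mul1r endo_mulDl endo_mulDr.

Lemma endo_cst_is_nmod_morphism : nmod_morphism endo_cst.
Proof.
split=> [|c d]; apply: endo_ext => v; rewrite /endo_fun /=.
  exact: scale0r.
exact: scalerDl.
Qed.
Lemma endo_cst_is_monoid_morphism : monoid_morphism endo_cst.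
Proof.
split=> [|c d]; apply: endo_ext => v; rewrite /endo_fun /=.
  exact: scale1r.
by rewrite scalerA.
Qed.

HB.instance Definition _ := GRing.isNmodMorphism.Build k endo endo_cst
  endo_cst_is_nmod_morphism.
HB.instance Definition _ := GRing.isMonoidMorphism.Build k endo endo_cst
  endo_cst_is_monoid_morphism.

Lemma endo_cst_central (c : k) (f : endo) : endo_cst c * f = f * endo_cst c.
Proof.
by apply: endo_ext => v; rewrite /endo_fun /= -[RHS]/(f (c *: v)) linearZ.
Qed.

Definition endo_alg : algebra k := Algebra endo_cst_central.
End Endomorphisms.

Inductive alg_term (k X : Type) : Type :=
| TGen of X
| TCst of k
| TAdd of alg_term k X & alg_term k X
| TMul of alg_term k X & alg_term k X.
Arguments TGen {k X}.
Arguments TCst {k X}.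

Section Presentation.
Variables (k : comPzRingType) (X : Type).
Local Notation term := (alg_term k X).
Variable R : term -> term -> Prop.

(* The congruence generated by R and the axioms of associative unital
   k-algebras, where [TCst] stands for the structure morphism. *)
Inductive alg_cong : term -> term -> Prop :=
| AC_rel s t : R s t -> alg_cong s t
| AC_refl t : alg_cong t t
| AC_sym s t : alg_cong s t -> alg_cong t s
| AC_trans s t u : alg_cong s t -> alg_cong t u -> alg_cong s u
| AC_add s s' t t' :
    alg_cong s s' -> alg_cong t t' -> alg_cong (TAdd s t) (TAdd s' t')
| AC_mul s s' t t' :
    alg_cong s s' -> alg_cong t t' -> alg_cong (TMul s t) (TMul s' t')
| AC_addA s t u : alg_cong (TAdd s (TAdd t u)) (TAdd (TAdd s t) u)
| AC_addC s t : alg_cong (TAdd s t) (TAdd t s)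
| AC_add0 t : alg_cong (TAdd (TCst 0) t) t
| AC_addN t : alg_cong (TAdd (TMul (TCst (-1)) t) t) (TCst 0)
| AC_mulA s t u : alg_cong (TMul s (TMul t u)) (TMul (TMul s t) u)
| AC_mul1l t : alg_cong (TMul (TCst 1) t) t
| AC_mul1r t : alg_cong (TMul t (TCst 1)) t
| AC_mulDl s t u :
    alg_cong (TMul (TAdd s t) u) (TAdd (TMul s u) (TMul t u))
| AC_mulDr s t u :
    alg_cong (TMul s (TAdd t u)) (TAdd (TMul s t) (TMul s u))
| AC_cstD c d : alg_cong (TCst (c + d)) (TAdd (TCst c) (TCst d))
| AC_cstM c d : alg_cong (TCst (c * d)) (TMul (TCst c) (TCst d))
| AC_cstC c t : alg_cong (TMul (TCst c) t) (TMul t (TCst c)).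

Definition alg_congb (s t : {classic term}) : bool := `[< alg_cong s t >].

Lemma alg_congb_refl : reflexive alg_congb.
Proof. by move=> t; apply/asboolP; apply: AC_refl. Qed.

Lemma alg_congb_sym : symmetric alg_congb.
Proof. by move=> s t; apply/asboolP/asboolP; apply: AC_sym. Qed.

Lemma alg_congb_trans : transitive alg_congb.
Proof.
by move=> t s u /asboolP st /asboolP tu; apply/asboolP; apply: AC_trans st tu.
Qed.

Canonical alg_cong_equiv :=
  EquivRel alg_congb alg_congb_refl alg_congb_sym alg_congb_trans.

Definition presented_alg : Type := {eq_quot alg_cong_equiv}.

HB.instance Definition _ := Choice.copy presented_alg {eq_quot alg_cong_equiv}.
HB.instance Definition _ :=
  EqQuotient.copy presented_alg {eq_quot alg_cong_equiv}.

Local Notation P := presented_alg.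
Local Notation cl t := (\pi_P (t : {classic term})).

Lemma pres_eqP (s t : {classic term}) : cl s = cl t <-> alg_cong s t.
Proof.
split=> [/eqP|st]; first by rewrite piE => /asboolP.
by apply/eqP; rewrite piE; apply/asboolP.
Qed.

Definition pres_gen (x : X) : P := cl (TGen x).
Definition pres_cst (c : k) : P := cl (TCst c).
Definition pres_add (a b : P) : P := cl (TAdd (repr a) (repr b)).
Definition pres_mul (a b : P) : P := cl (TMul (repr a) (repr b)).
Definition pres_opp (a : P) : P := pres_mul (pres_cst (-1)) a.

Lemma pres_repr (t : {classic term}) : alg_cong (repr (cl t)) t.
Proof. by apply/pres_eqP; rewrite reprK. Qed.

Lemma pres_addE s t : pres_add (cl s) (cl t) = cl (TAdd s t).
Proof. by apply/pres_eqP; apply: AC_add; apply: pres_repr. Qed.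

Lemma pres_mulE s t : pres_mul (cl s) (cl t) = cl (TMul s t).
Proof. by apply/pres_eqP; apply: AC_mul; apply: pres_repr. Qed.

Let presE := (pres_addE, pres_mulE).

Lemma pres_ind (Q : P -> Prop) : (forall t : term, Q (cl t)) -> forall a, Q a.
Proof. by move=> H a; rewrite -[a]reprK; apply: H. Qed.

Lemma pres_addA : associative pres_add.
Proof.
elim/pres_ind=> s; elim/pres_ind=> t; elim/pres_ind=> u.
by rewrite !presE; apply/pres_eqP; apply: AC_addA.
Qed.
Lemma pres_addC : commutative pres_add.
Proof.
elim/pres_ind=> s; elim/pres_ind=> t.
by rewrite !presE; apply/pres_eqP; apply: AC_addC.
Qed.
Lemma pres_add0 : left_id (pres_cst 0) pres_add.
Proof. by elim/pres_ind=> s; rewrite !presE; apply/pres_eqP; apply: AC_add0. Qed.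
Lemma pres_addN : left_inverse (pres_cst 0) pres_opp pres_add.
Proof.
by elim/pres_ind=> s; rewrite /pres_opp /pres_cst !presE; apply/pres_eqP; apply: AC_addN.
Qed.

HB.instance Definition _ := GRing.isZmodule.Build P
  pres_addA pres_addC pres_add0 pres_addN.

Lemma pres_mulA : associative pres_mul.
Proof.
elim/pres_ind=> s; elim/pres_ind=> t; elim/pres_ind=> u.
by rewrite !presE; apply/pres_eqP; apply: AC_mulA.
Qed.
Lemma pres_mul1l : left_id (pres_cst 1) pres_mul.
Proof. by elim/pres_ind=> s; rewrite !presE; apply/pres_eqP; apply: AC_mul1l. Qed.
Lemma pres_mul1r : right_id (pres_cst 1) pres_mul.
Proof. by elim/pres_ind=> s; rewrite !presE; apply/pres_eqP; apply: AC_mul1r. Qed.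
Lemma pres_mulDl : left_distributive pres_mul pres_add.
Proof.
elim/pres_ind=> s; elim/pres_ind=> t; elim/pres_ind=> u.
by rewrite !presE; apply/pres_eqP; apply: AC_mulDl.
Qed.
Lemma pres_mulDr : right_distributive pres_mul pres_add.
Proof.
elim/pres_ind=> s; elim/pres_ind=> t; elim/pres_ind=> u.
by rewrite !presE; apply/pres_eqP; apply: AC_mulDr.
Qed.

HB.instance Definition _ := GRing.Zmodule_isPzRing.Build P
  pres_mulA pres_mul1l pres_mul1r pres_mulDl pres_mulDr.

Lemma pres_cst_is_nmod_morphism : nmod_morphism pres_cst.
Proof.
split=> // c d; rewrite [RHS]pres_addE; apply/pres_eqP; exact: AC_cstD.
Qed.
Lemma pres_cst_is_monoid_morphism : monoid_morphism pres_cst.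
Proof.
split=> // c d; rewrite [RHS]pres_mulE; apply/pres_eqP; exact: AC_cstM.
Qed.

HB.instance Definition _ := GRing.isNmodMorphism.Build k P pres_cst
  pres_cst_is_nmod_morphism.
HB.instance Definition _ := GRing.isMonoidMorphism.Build k P pres_cst
  pres_cst_is_monoid_morphism.

Lemma pres_central (c : k) (x : P) : pres_cst c * x = x * pres_cst c.
Proof.
elim/pres_ind: x => s; rewrite [LHS]pres_mulE [RHS]pres_mulE.
by apply/pres_eqP; apply: AC_cstC.
Qed.

Definition pres_alg : algebra k := Algebra pres_central.

Section Lift.
Variables (B : algebra k) (f : X -> B).

Fixpoint term_eval (t : term) : B :=
  match t with
  | TGen x => f x
  | TCst c => alg_str B c
  | TAdd s t => term_eval s + term_eval t
  | TMul s t => term_eval s * term_eval t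
  end.

Definition pres_lift (a : pres_alg) : B := term_eval (repr a).

Hypothesis fR : forall s t, R s t -> term_eval s = term_eval t.

Lemma term_eval_cong s t : alg_cong s t -> term_eval s = term_eval t.
Proof.
elim=> //=.
- by move=> ? ? ? _ -> _ ->.
- by move=> ? ? ? ? _ -> _ ->.
- by move=> ? ? ? ? _ -> _ ->.
- by move=> *; rewrite addrA.
- by move=> *; rewrite addrC.
- by move=> *; rewrite rmorph0 add0r.
- by move=> *; rewrite rmorph0 rmorphN1 mulN1r addNr.
- by move=> *; rewrite mulrA.
- by move=> *; rewrite rmorph1 mul1r.
- by move=> *; rewrite rmorph1 mulr1.
- by move=> *; rewrite mulrDl.
- by move=> *; rewrite mulrDr.
- by move=> *; rewrite rmorphD.
- by move=> *; rewrite rmorphM.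
- by move=> *; rewrite alg_central.
Qed.

Lemma pres_lift_cl t : pres_lift (cl t) = term_eval t.
Proof. by apply: term_eval_cong; apply: pres_repr. Qed.

Lemma pres_lift_gen x : pres_lift (pres_gen x) = f x.
Proof. exact: pres_lift_cl. Qed.

Lemma pres_lift_morphism : alg_morphism pres_lift.
Proof.
split=> [||c]; first split=> [|x y]; last 1 first.
- exact: pres_lift_cl.
- by rewrite [LHS]pres_lift_cl /= rmorph0.
- elim/pres_ind: x => s; elim/pres_ind: y => t.
  by rewrite -[_ + _]/(pres_add _ _) pres_addE !pres_lift_cl.
split=> [|x y]; first by rewrite [LHS]pres_lift_cl /= rmorph1.
elim/pres_ind: x => s; elim/pres_ind: y => t.
by rewrite -[cl s * _]/(pres_mul _ _) pres_mulE !pres_lift_cl.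
Qed.

Lemma pres_lift_unique (g : pres_alg -> B) :
  alg_morphism g -> (forall x, g (pres_gen x) = f x) -> g =1 pres_lift.
Proof.
move=> [[g0 gD] [g1 gM] gC] gX.
elim/pres_ind=> t; rewrite pres_lift_cl.
elim: t => [x|c|s IHs t IHt|s IHs t IHt] /=.
- exact: gX.
- exact: gC.
- by rewrite -pres_addE -IHs -IHt -gD.
- by rewrite -pres_mulE -IHs -IHt -gM.
Qed.

End Lift.
End Presentation.

Arguments pres_gen {k X R} x.
Arguments pres_lift {k X R B} f a.

Definition free_alg (k : comPzRingType) (X : Type) : algebra k :=
  @pres_alg k X (fun _ _ => False).

Section FreeProduct.
Variables (k : comPzRingType) (A B : algebra k).

Inductive free_prod_rel :
    alg_term k (A + B) -> alg_term k (A + B) -> Prop :=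
| FP_add1 (a a' : A) :
    free_prod_rel (TGen (inl (a + a'))) (TAdd (TGen (inl a)) (TGen (inl a')))
| FP_mul1 (a a' : A) :
    free_prod_rel (TGen (inl (a * a'))) (TMul (TGen (inl a)) (TGen (inl a')))
| FP_cst1 c : free_prod_rel (TGen (inl (alg_str A c))) (TCst c)
| FP_add2 (b b' : B) :
    free_prod_rel (TGen (inr (b + b'))) (TAdd (TGen (inr b)) (TGen (inr b')))
| FP_mul2 (b b' : B) :
    free_prod_rel (TGen (inr (b * b'))) (TMul (TGen (inr b)) (TGen (inr b')))
| FP_cst2 c : free_prod_rel (TGen (inr (alg_str B c))) (TCst c).

(* The free product A * B, i.e. the coproduct of associative unital
   k-algebras: see [free_prod_lift_morphism] and [free_prod_lift_unique]. *)
Definition free_prod : algebra k := @pres_alg k (A + B) free_prod_rel.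

Definition fp_inl (a : A) : free_prod := pres_gen (inl a).
Definition fp_inr (b : B) : free_prod := pres_gen (inr b).

Lemma fp_inl_morphism : alg_morphism fp_inl.
Proof.
have cst c : fp_inl (alg_str A c) = alg_str free_prod c.
  by apply/pres_eqP/AC_rel/FP_cst1.
split=> //; split=> [|a a'].
- by rewrite -(rmorph0 (alg_str A)) cst rmorph0.
- by rewrite [RHS]pres_addE; apply/pres_eqP/AC_rel/FP_add1.
- by rewrite -(rmorph1 (alg_str A)) cst rmorph1.
- by rewrite [RHS]pres_mulE; apply/pres_eqP/AC_rel/FP_mul1.
Qed.

Lemma fp_inr_morphism : alg_morphism fp_inr.
Proof.
have cst c : fp_inr (alg_str B c) = alg_str free_prod c.
  by apply/pres_eqP/AC_rel/FP_cst2.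
split=> //; split=> [|b b'].
- by rewrite -(rmorph0 (alg_str B)) cst rmorph0.
- by rewrite [RHS]pres_addE; apply/pres_eqP/AC_rel/FP_add2.
- by rewrite -(rmorph1 (alg_str B)) cst rmorph1.
- by rewrite [RHS]pres_mulE; apply/pres_eqP/AC_rel/FP_mul2.
Qed.

Section Lift.
Variables (C : algebra k) (f : A -> C) (g : B -> C).

Definition fp_case (x : A + B) : C :=
  match x with inl a => f a | inr b => g b end.

Definition free_prod_lift : free_prod -> C := pres_lift fp_case.

Hypotheses (fM : alg_morphism f) (gM : alg_morphism g).

Lemma free_prod_rel_eval s t :
  free_prod_rel s t -> term_eval fp_case s = term_eval fp_case t.
Proof.
by case: fM gM => [[_ fD] [_ fm] fc] [[_ gD] [_ gm] gc]; case=> /=.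
Qed.

Lemma free_prod_lift_morphism : alg_morphism free_prod_lift.
Proof. exact: pres_lift_morphism free_prod_rel_eval. Qed.

Lemma free_prod_lift_inl a : free_prod_lift (fp_inl a) = f a.
Proof. exact: (pres_lift_gen free_prod_rel_eval). Qed.

Lemma free_prod_lift_inr b : free_prod_lift (fp_inr b) = g b.
Proof. exact: (pres_lift_gen free_prod_rel_eval). Qed.

Lemma free_prod_lift_unique (h : free_prod -> C) : alg_morphism h ->
  (forall a, h (fp_inl a) = f a) -> (forall b, h (fp_inr b) = g b) ->
  h =1 free_prod_lift.
Proof.
move=> hM ha hb; apply: (pres_lift_unique free_prod_rel_eval) => //.
by case=> x; [apply: ha|apply: hb].
Qed.

End Lift.
End FreeProduct.

Definition two_sided_ideal (R : pzRingType) (I : set R) : Prop :=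
  [/\ I 0, forall x y, I x -> I y -> I (x - y),
      forall a x, I x -> I (a * x) & forall a x, I x -> I (x * a)].

Record ideal (R : pzRingType) := Ideal {
  ideal_set :> R -> Prop;
  idealP : two_sided_ideal ideal_set
}.

Lemma generated_idealP (R : pzRingType) (S : set R) :
  two_sided_ideal (smallest (@two_sided_ideal R) S).
Proof.
split=> [I [[I0 _ _ _] _]|x y Sx Sy I HI|a x Sx I HI|a x Sx I HI] //;
  have [[_ IB Il Ir] _] := HI.
- by apply: IB; [apply: Sx|apply: Sy].
- by apply: Il; apply: Sx.
- by apply: Ir; apply: Sx.
Qed.

Definition generated_ideal (R : pzRingType) (S : set R) : ideal R :=
  Ideal (generated_idealP S).

Section QuotientRing.
Variables (R : pzRingType) (I : ideal R).

Definition ideal_eqv (x y : R) : bool := `[< I (x - y) >].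

Lemma ideal0 : I 0. Proof. by case: (idealP I). Qed.
Lemma idealB x y : I x -> I y -> I (x - y).
Proof. by case: (idealP I) => _ IB _ _; apply: IB. Qed.
Lemma idealN x : I x -> I (- x).
Proof. by move=> Ix; rewrite -[- x]add0r; apply: idealB => //; apply: ideal0. Qed.
Lemma idealD x y : I x -> I y -> I (x + y).
Proof. by move=> Ix Iy; rewrite -[y]opprK; apply: idealB => //; apply: idealN. Qed.
Lemma idealMl a x : I x -> I (a * x).
Proof. by case: (idealP I) => _ _ Il _; apply: Il. Qed.
Lemma idealMr a x : I x -> I (x * a).
Proof. by case: (idealP I) => _ _ _ Ir; apply: Ir. Qed.

Lemma ideal_eqv_refl : reflexive ideal_eqv.
Proof. by move=> x; apply/asboolP; rewrite subrr; apply: ideal0. Qed.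
Lemma ideal_eqv_sym : symmetric ideal_eqv.
Proof. by move=> x y; apply/asboolP/asboolP=> /idealN; rewrite opprB. Qed.
Lemma ideal_eqv_trans : transitive ideal_eqv.
Proof.
move=> y x z /asboolP xy /asboolP yz; apply/asboolP.
by rewrite -[x](subrK y) -addrA; apply: idealD.
Qed.

Canonical ideal_equiv :=
  EquivRel ideal_eqv ideal_eqv_refl ideal_eqv_sym ideal_eqv_trans.

Definition quotient_ring : Type := {eq_quot ideal_equiv}.

HB.instance Definition _ := Choice.copy quotient_ring {eq_quot ideal_equiv}.
HB.instance Definition _ :=
  EqQuotient.copy quotient_ring {eq_quot ideal_equiv}.

Local Notation Q := quotient_ring.

Definition quo (x : R) : Q := \pi_Q x.

Lemma quo_eqP x y : quo x = quo y <-> I (x - y).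
Proof.
split=> [/eqP|xy]; first by rewrite /quo piE => /asboolP.
by apply/eqP; rewrite /quo piE; apply/asboolP.
Qed.

Definition quo_opp (a : Q) : Q := quo (- repr a).
Definition quo_add (a b : Q) : Q := quo (repr a + repr b).
Definition quo_mul (a b : Q) : Q := quo (repr a * repr b).

Lemma quo_repr x : I (repr (quo x) - x).
Proof. by apply/quo_eqP; rewrite /quo reprK. Qed.

Lemma quo_oppE x : quo_opp (quo x) = quo (- x).
Proof. by apply/quo_eqP; rewrite -opprD; apply/idealN/quo_repr. Qed.
Lemma quo_addE x y : quo_add (quo x) (quo y) = quo (x + y).
Proof.
by apply/quo_eqP; rewrite opprD addrACA; apply: idealD; apply: quo_repr.
Qed.
Lemma quo_mulE x y : quo_mul (quo x) (quo y) = quo (x * y).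
Proof.
apply/quo_eqP; set x' := repr _; set y' := repr _.
have -> : x' * y' - x * y = (x' - x) * y' + x * (y' - y).
  by rewrite mulrBl mulrBr addrA subrK.
by apply: idealD; [apply/idealMr/quo_repr|apply/idealMl/quo_repr].
Qed.

Let quoE := (quo_oppE, quo_addE, quo_mulE).

Lemma quo_ind (S : Q -> Prop) : (forall x, S (quo x)) -> forall a, S a.
Proof. by move=> H a; rewrite -[a]reprK; apply: H. Qed.

Lemma quo_addA : associative quo_add.
Proof.
by elim/quo_ind=> x; elim/quo_ind=> y; elim/quo_ind=> z; rewrite !quoE addrA.
Qed.
Lemma quo_addC : commutative quo_add.
Proof. by elim/quo_ind=> x; elim/quo_ind=> y; rewrite !quoE addrC. Qed.
Lemma quo_add0 : left_id (quo 0) quo_add.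
Proof. by elim/quo_ind=> x; rewrite !quoE add0r. Qed.
Lemma quo_addN : left_inverse (quo 0) quo_opp quo_add.
Proof. by elim/quo_ind=> x; rewrite !quoE addNr. Qed.

HB.instance Definition _ := GRing.isZmodule.Build Q
  quo_addA quo_addC quo_add0 quo_addN.

Lemma quo_mulA : associative quo_mul.
Proof.
by elim/quo_ind=> x; elim/quo_ind=> y; elim/quo_ind=> z; rewrite !quoE mulrA.
Qed.
Lemma quo_mul1l : left_id (quo 1) quo_mul.
Proof. by elim/quo_ind=> x; rewrite !quoE mul1r. Qed.
Lemma quo_mul1r : right_id (quo 1) quo_mul.
Proof. by elim/quo_ind=> x; rewrite !quoE mulr1. Qed.
Lemma quo_mulDl : left_distributive quo_mul quo_add.
Proof.
by elim/quo_ind=> x; elim/quo_ind=> y; elim/quo_ind=> z; rewrite !quoE mulrDl.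
Qed.
Lemma quo_mulDr : right_distributive quo_mul quo_add.
Proof.
by elim/quo_ind=> x; elim/quo_ind=> y; elim/quo_ind=> z; rewrite !quoE mulrDr.
Qed.

HB.instance Definition _ := GRing.Zmodule_isPzRing.Build Q
  quo_mulA quo_mul1l quo_mul1r quo_mulDl quo_mulDr.

Lemma quo_is_nmod_morphism : nmod_morphism quo.
Proof. by split=> // x y; rewrite {2}/GRing.add /= quo_addE. Qed.
Lemma quo_is_monoid_morphism : monoid_morphism quo.
Proof. by split=> // x y; rewrite {2}/GRing.mul /= quo_mulE. Qed.

HB.instance Definition _ := GRing.isNmodMorphism.Build R Q quo
  quo_is_nmod_morphism.
HB.instance Definition _ := GRing.isMonoidMorphism.Build R Q quo
  quo_is_monoid_morphism.

End QuotientRing.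

(* A finite sequence of factors y_i or |_u_|_omega with u again such a sequence:
   [wvar i w] is y_i w and [wbr o u w] is |_u_|_o w. *)
Inductive word (Omega : Type) : Type :=
| wnil
| wvar of nat & word Omega
| wbr of Omega & word Omega & word Omega.
Arguments wnil {Omega}.
Arguments wvar {Omega}.

Section Words.
Variable Omega : Type.
Local Notation word := (word Omega).

(* Permutation of the factors, at every depth. *)
Inductive weq : word -> word -> Prop :=
| weq_nil : weq wnil wnil
| weq_var i w w' : weq w w' -> weq (wvar i w) (wvar i w')
| weq_br o u u' w w' : weq u u' -> weq w w' -> weq (wbr o u w) (wbr o u' w')
| weq_swap_vv i j w : weq (wvar i (wvar j w)) (wvar j (wvar i w))
| weq_swap_vb i o u w : weq (wvar i (wbr o u w)) (wbr o u (wvar i w))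
| weq_swap_bv i o u w : weq (wbr o u (wvar i w)) (wvar i (wbr o u w))
| weq_swap_bb o u o' u' w :
    weq (wbr o u (wbr o' u' w)) (wbr o' u' (wbr o u w))
| weq_trans u v w : weq u v -> weq v w -> weq u w.

Lemma weq_refl w : weq w w.
Proof.
elim: w => [|i w IH|o u IHu w IHw]; first exact: weq_nil.
- exact: weq_var.
- exact: weq_br.
Qed.

Lemma weq_sym u v : weq u v -> weq v u.
Proof.
elim=> [||||||o u1 o' u2 w|? ? ? _ IH1 _ IH2]; do ?by constructor.
exact: weq_trans IH2 IH1.
Qed.

Definition weqb (u v : {classic word}) : bool := `[< weq u v >].

Lemma weqb_refl : reflexive weqb.
Proof. by move=> w; apply/asboolP; apply: weq_refl. Qed.
Lemma weqb_sym : symmetric weqb.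
Proof. by move=> u v; apply/asboolP/asboolP; apply: weq_sym. Qed.
Lemma weqb_trans : transitive weqb.
Proof.
by move=> v u w /asboolP uv /asboolP vw; apply/asboolP; apply: weq_trans uv vw.
Qed.

Canonical weq_equiv := EquivRel weqb weqb_refl weqb_sym weqb_trans.

(* The monoid of commutative bracket words in y_0, y_1, ...; the n-th stage of
   its construction consists of the words of bracket depth at most n. *)
Definition cword : Type := {eq_quot weq_equiv}.

HB.instance Definition _ := Choice.copy cword {eq_quot weq_equiv}.
HB.instance Definition _ := EqQuotient.copy cword {eq_quot weq_equiv}.

Definition cword_of (w : word) : cword := \pi_cword (w : {classic word}).

Lemma cword_eqP u v : cword_of u = cword_of v <-> weq u v.
Proof.
rewrite /cword_of; split=> [/eqP|uv]; first by rewrite piE => /asboolP.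
by apply/eqP; rewrite piE; apply/asboolP.
Qed.

Lemma weq_repr w : weq (repr (cword_of w)) w.
Proof. by apply/cword_eqP; rewrite /cword_of reprK. Qed.

Fixpoint word_occ (i : nat) (w : word) : nat :=
  match w with
  | wnil => 0
  | wvar j w => (j == i) + word_occ i w
  | wbr _ u w => word_occ i u + word_occ i w
  end.

Fixpoint word_degree (w : word) : nat :=
  match w with
  | wnil => 0
  | wvar _ w => (word_degree w).+1
  | wbr _ u w => word_degree u + word_degree w
  end.

Fixpoint word_rename (s : nat -> nat) (w : word) : word :=
  match w with
  | wnil => wnil
  | wvar i w => wvar (s i) (word_rename s w)
  | wbr o u w => wbr o (word_rename s u) (word_rename s w)
  end.

Definition occ (i : nat) (w : cword) : nat := word_occ i (repr w).
(* Only variables count in the total degree, not brackets. *)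
Definition degree (w : cword) : nat := word_degree (repr w).
Definition rename (s : nat -> nat) (w : cword) : cword :=
  cword_of (word_rename s (repr w)).
(* y_i w and |_u_|_o w. *)
Definition cvar (i : nat) (w : cword) : cword := cword_of (wvar i (repr w)).
Definition cbr (o : Omega) (u w : cword) : cword :=
  cword_of (wbr o (repr u) (repr w)).

Lemma word_occ_weq i u v : weq u v -> word_occ i u = word_occ i v.
Proof.
by elim=> //= *; do ?[lia | congruence].
Qed.
Lemma word_degree_weq u v : weq u v -> word_degree u = word_degree v.
Proof. by elim=> //= *; do ?[lia | congruence]. Qed.
Lemma word_rename_weq s u v :
  weq u v -> weq (word_rename s u) (word_rename s v).
Proof.
elim=> /=; do ?by constructor.
by move=> ? ? ? _ H1 _ H2; apply: weq_trans H1 H2.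
Qed.

Lemma occE i w : occ i (cword_of w) = word_occ i w.
Proof. by apply/word_occ_weq/weq_repr. Qed.
Lemma degreeE w : degree (cword_of w) = word_degree w.
Proof. by apply/word_degree_weq/weq_repr. Qed.
Lemma renameE s w : rename s (cword_of w) = cword_of (word_rename s w).
Proof. by apply/cword_eqP/word_rename_weq/weq_repr. Qed.
Lemma cvarE i w : cvar i (cword_of w) = cword_of (wvar i w).
Proof. by apply/cword_eqP/weq_var/weq_repr. Qed.
Lemma cbrE o u w : cbr o (cword_of u) (cword_of w) = cword_of (wbr o u w).
Proof. by apply/cword_eqP/weq_br; apply: weq_repr. Qed.

End Words.

Definition law (k : comPzRingType) (Omega : Type) : Type :=
  {malg k[cword Omega]}.

Section LawModule.
Variables (k : comPzRingType) (Omega : Type).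
Local Notation law := (law k Omega).
Implicit Types (l : {malg k[cword Omega]}) (c : k).

HB.instance Definition _ := GRing.Zmodule.copy law {malg k[cword Omega]}.

Definition law_scale c l : law := [malg w in msupp l => c * l@_w].

Lemma law_scaleE c l w : (law_scale c l : {malg k[cword Omega]})@_w = c * l@_w.
Proof.
rewrite /law_scale mcoeffE; case: ifPn => // wl.
by rewrite mcoeff_outdom ?mulr0.
Qed.

Lemma law_scaleA a b l : law_scale a (law_scale b l) = law_scale (a * b) l.
Proof. by apply/malgP=> w; rewrite !law_scaleE mulrA. Qed.
Lemma law_scale1 : left_id 1 law_scale.
Proof. by move=> l; apply/malgP=> w; rewrite law_scaleE mul1r. Qed.
Lemma law_scaleDr : right_distributive law_scale +%R.
Proof.
by move=> c l l'; apply/malgP=> w; rewrite !(law_scaleE, mcoeffD) mulrDr.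
Qed.
Lemma law_scaleDl l : {morph law_scale^~ l : a b / a + b}.
Proof.
by move=> a b; apply/malgP=> w; rewrite !(law_scaleE, mcoeffD) mulrDl.
Qed.

HB.instance Definition _ := GRing.Zmodule_isLmodule.Build k law
  law_scaleA law_scale1 law_scaleDr law_scaleDl.
End LawModule.

Definition submodule (k : comPzRingType) (V : lmodType k) (E : set V) : Prop :=
  GRing.submod_closed (mem E).

Section Laws.
Variables (k : comPzRingType) (Omega : Type).
Local Notation law := (law k Omega).
Implicit Types (l b : law).

Definition monomials l : {fset cword Omega} := msupp l.
Definition coefficient l (w : cword Omega) : k := mcoeff w l.

Definition homogeneous (d : nat) l : Prop :=
  forall w, w \in monomials l -> degree w = d.

Definition multilinear l : Prop :=
  forall i, (exists2 w, w \in monomials l & (0 < occ i w)%N) ->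
  forall w, w \in monomials l -> occ i w = 1.

(* Total degree n + 1 in the variables y_0, ..., y_n. *)
Definition standard_form (n : nat) l : Prop :=
  [/\ homogeneous n.+1 l, multilinear l &
      forall w i, w \in monomials l -> (0 < occ i w)%N -> (i <= n)%N].

Definition law_rename (s : nat -> nat) l : law :=
  \sum_(w <- monomials l) << coefficient l w *g rename s w >>.

Definition renaming_of b l : Prop :=
  exists2 s : nat -> nat, injective s & l = law_rename s b.

(* S is a set of standard laws for E: E is spanned by a set B of homogeneous
   multilinear elements of positive total degree, and S consists of renamings
   of the elements of B to the variables y_0, ..., y_n, where every element of
   B is renamed.  If E is spanned by elements that are already in standard form,
   one can take for S the set of all elements of E in standard form.  The choice
   of the renamings affects the relators, as y_0 plays a special role there. *)
Definition standard_laws (E S : set law) : Prop :=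
  exists B : set law,
  [/\ E = smallest (@submodule k law) B,
      forall b, B b -> (exists d, homogeneous d.+1 b) /\ multilinear b,
      forall b, B b -> exists2 l, S l & renaming_of b l &
      forall l, S l ->
        (exists n, standard_form n l) /\ (exists2 b, B b & renaming_of b l)].

End Laws.

Record com_operated_algebra (k : comPzRingType) (Omega : Type) := ComOperatedAlgebra {
  oa_ring :> comPzRingType;
  oa_str : {rmorphism k -> oa_ring};
  oa_op : Omega -> {linear restr oa_str oa_ring^o -> restr oa_str oa_ring^o}
}.

Definition oa_alg (k : comPzRingType) (Omega : Type)
    (A : com_operated_algebra k Omega) : algebra k :=
  com_algebra (@oa_str k Omega A).

Section Operators.
Variables (k : comPzRingType) (Omega : Type) (A : com_operated_algebra k Omega).
Local Notation P := (@oa_op k Omega A).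

Fixpoint word_eval (a : nat -> A) (w : word Omega) : A :=
  match w with
  | wnil => 1
  | wvar i w => a i * word_eval a w
  | wbr o u w => (P o (word_eval a u) : A) * word_eval a w
  end.

Definition cword_eval (a : nat -> A) (w : cword Omega) : A :=
  word_eval a (repr w).

Definition law_eval (a : nat -> A) (l : law k Omega) : A :=
  \sum_(w <- monomials l) oa_str A (coefficient l w) * cword_eval a w.

Definition E_algebra (E : set (law k Omega)) : Prop :=
  forall l, E l -> forall a : nat -> A, law_eval a l = 0.

Lemma word_eval_weq a u v : weq u v -> word_eval a u = word_eval a v.
Proof.
elim=> //=.
- by move=> ? ? ? _ ->.
- by move=> ? ? ? ? ? _ -> _ ->.
- by move=> *; rewrite mulrCA.
- by move=> *; rewrite mulrCA.
- by move=> *; rewrite mulrCA.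
- by move=> *; rewrite mulrCA.
- by move=> ? ? ? _ -> _ ->.
Qed.

Lemma cword_evalE a w : cword_eval a (cword_of w) = word_eval a w.
Proof. by apply/word_eval_weq/weq_repr. Qed.

(* The ring of free operators A[Omega] = A * k<Omega>. *)
Definition free_operators : algebra k := free_prod (oa_alg A) (free_alg k Omega).

Definition op_of_alg (a : A) : free_operators :=
  @fp_inl k (oa_alg A) (free_alg k Omega) a.
Definition op_of_sym (o : Omega) : free_operators :=
  @fp_inr k (oa_alg A) (free_alg k Omega) (pres_gen o).

(* The relator of a monomial containing y_0 exactly once; it does not use the
   value of a at 0.  See [cword_relator_var] and [cword_relator_br]. *)
Fixpoint word_relator (a : nat -> A) (w : word Omega) : free_operators :=
  match w with
  | wnil => 0
  | wvar i t =>
      if i == 0 then op_of_alg (word_eval a t)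
      else op_of_alg (a i) * word_relator a t
  | wbr o u t =>
      if (0 < word_occ 0 u)%N
      then op_of_alg (word_eval a t) * op_of_sym o * word_relator a u
      else op_of_alg (P o (word_eval a u)) * word_relator a t
  end.

Definition cword_relator (a : nat -> A) (w : cword Omega) : free_operators :=
  word_relator a (repr w).

Definition relator (a : nat -> A) (l : law k Omega) : free_operators :=
  \sum_(w <- monomials l)
    alg_str free_operators (coefficient l w) * cword_relator a w.

Lemma op_of_alg_morphism : @alg_morphism k (oa_alg A) free_operators op_of_alg.
Proof. exact: fp_inl_morphism. Qed.

Lemma op_of_algM a b : op_of_alg (a * b) = op_of_alg a * op_of_alg b.
Proof. by case: op_of_alg_morphism => _ [_ ->]. Qed.

Lemma word_relator_weq a u v : weq u v -> (word_occ 0 u <= 1)%N ->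
  word_relator a u = word_relator a v.
Proof.
elim=> {u v} //=.
- move=> i w w' ww' IH; case: eqP => [_|_] H; last by rewrite IH //; lia.
  by rewrite (word_eval_weq a ww').
- move=> o u u' w w' uu' IHu ww' IHw H.
  rewrite (word_occ_weq 0 uu') (word_eval_weq a uu') (word_eval_weq a ww').
  by case: ifP => _; [rewrite IHu //|rewrite IHw //]; lia.
- move=> i j w; case: eqP => [i0|_]; case: eqP => [j0|_] //= _.
  + by rewrite op_of_algM.
  + by rewrite op_of_algM.
  + by rewrite !mulrA -!op_of_algM mulrC.
- move=> i o u w; case: eqP => [->|_] /=.
    by case: ifP => [|_ _]; [lia|rewrite op_of_algM].
  by case: ifP => _ _; rewrite ?op_of_algM !mulrA // -!op_of_algM mulrC.
- move=> i o u w; case: eqP => [->|_] /=.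
    by case: ifP => [|_ _]; [lia|rewrite op_of_algM].
  by case: ifP => _ _; rewrite ?op_of_algM !mulrA // -!op_of_algM mulrC.
- move=> o u o' u' w; case: ifP => [Hu|_]; case: ifP => [Hu'|_]; first by lia.
  + by rewrite op_of_algM !mulrA.
  + by rewrite op_of_algM !mulrA.
  + by rewrite !mulrA -!op_of_algM mulrC.
- by move=> u v w uv IH1 _ IH2 H; rewrite IH1 // IH2 // -(word_occ_weq 0 uv).
Qed.

Lemma cword_relator_var a (t : cword Omega) : occ 0 t = 0 ->
  cword_relator a (cvar 0 t) = op_of_alg (cword_eval a t).
Proof.
move=> Ht; rewrite /cword_relator /cvar.
rewrite -(@word_relator_weq a (wvar 0 (repr t))) //=.
  exact/weq_sym/weq_repr.
by rewrite -/(occ 0 t) Ht.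
Qed.

Lemma cword_relator_br a o (u t : cword Omega) : occ 0 t = 0 -> occ 0 u = 1 ->
  cword_relator a (cbr o u t) =
  op_of_alg (cword_eval a t) * op_of_sym o * cword_relator a u.
Proof.
move=> Ht Hu; rewrite {1}/cword_relator /cbr.
rewrite -(@word_relator_weq a (wbr o (repr u) (repr t))) /=.
- by rewrite -/(occ 0 u) Hu.
- exact/weq_sym/weq_repr.
- by rewrite -/(occ 0 u) -/(occ 0 t) Hu Ht.
Qed.

(* [E], for the set S of standard laws for E. *)
Definition relator_ideal (S : set (law k Omega)) : ideal free_operators :=
  generated_ideal
    [set L : free_operators | exists2 l, S l & exists a : nat -> A, L = relator a l].

Definition E_operators (S : set (law k Omega)) : pzRingType :=
  quotient_ring (relator_ideal S).

Record operated_module := OperatedModule {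
  om_mod :> lmodType A;
  om_op : Omega -> {linear restr (oa_str A) om_mod -> restr (oa_str A) om_mod}
}.

Section Action.
Variable M : operated_module.
Local Notation kM := (restr (oa_str A) M).

Definition scalar_action (a : A) (m : kM) : kM := a *: (m : M).

Lemma scalar_action_is_linear a : linear (scalar_action a).
Proof.
move=> c u v; rewrite /scalar_action [LHS](@scalerDr A M); congr (_ + _).
by rewrite [LHS](@scalerA A M) [RHS](@scalerA A M) mulrC.
Qed.
HB.instance Definition _ a :=
  GRing.isLinear.Build k kM kM *:%R (scalar_action a)
    (scalar_action_is_linear a).

Definition alg_action (a : oa_alg A) : endo_alg kM :=
  (scalar_action a : {linear kM -> kM}).
Definition sym_action (x : free_alg k Omega) : endo_alg kM :=
  @pres_lift k Omega _ (endo_alg kM) (om_op M) x.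

Lemma alg_action_morphism : alg_morphism alg_action.
Proof.
split=> [||c]; first split=> [|a b]; last 1 first.
- exact: endo_ext.
- by apply: endo_ext => m; apply: (@scale0r A M).
- by apply: endo_ext => m; apply: (@scalerDl A M).
split=> [|a b]; apply: endo_ext => m; first exact: (@scale1r A M).
by apply/esym/(@scalerA A M).
Qed.

Lemma sym_action_morphism : alg_morphism sym_action.
Proof. exact: pres_lift_morphism. Qed.

Definition op_action (L : free_operators) (m : M) : M :=
  endo_fun (free_prod_lift alg_action sym_action L) m.

Lemma op_action_alg a m : op_action (op_of_alg a) m = a *: m.
Proof.
by rewrite /op_action
  (free_prod_lift_inl alg_action_morphism sym_action_morphism).
Qed.

Lemma op_action_sym o m : op_action (op_of_sym o) m = om_op M o m.
Proof.
rewrite /op_action (free_prod_lift_inr alg_action_morphism sym_action_morphism).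
by rewrite /sym_action pres_lift_gen.
Qed.

Lemma op_action_module :
  [/\ forall m, op_action 1 m = m,
      forall L L' m, op_action (L * L') m = op_action L (op_action L' m),
      forall L L' m, op_action (L + L') m = op_action L m + op_action L' m &
      forall L m m', op_action L (m + m') = op_action L m + op_action L m'].
Proof.
have [[_ FD] [F1 FM] _] :=
  free_prod_lift_morphism alg_action_morphism sym_action_morphism.
split=> [m|L L' m|L L' m|L m m']; rewrite /op_action ?F1 ?FM ?FD //.
by rewrite /endo_fun [LHS](@raddfD kM kM).
Qed.

End Action.

Definition E_module (S : set (law k Omega)) (M : operated_module) : Prop :=
  forall L, relator_ideal S L -> forall m : M, op_action L m = 0.

Definition commutes_with_ops (M N : operated_module) (phi : {linear M -> N}) :
    Prop :=
  forall o (m : M), phi (om_op M o m) = om_op N o (phi m).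

Definition operated_hom (M N : operated_module) : Type :=
  {phi : {linear M -> N} | commutes_with_ops phi}.

End Operators.

Record category := Category {
  obj : Type;
  hom : obj -> obj -> Type;
  cid_ : forall x, hom x x;
  ccomp : forall x y z, hom y z -> hom x y -> hom x z;
  ccomp1l : forall x y (f : hom x y), ccomp (cid_ y) f = f;
  ccomp1r : forall x y (f : hom x y), ccomp f (cid_ x) = f;
  ccompA : forall x y z t (h : hom z t) (g : hom y z) (f : hom x y),
    ccomp h (ccomp g f) = ccomp (ccomp h g) f
}.
Arguments hom {c} _ _.
Arguments cid_ {c} x.
Arguments ccomp {c x y z} _ _.

Record functor (C D : category) := Functor {
  fobj : obj C -> obj D;
  fhom : forall x y, hom x y -> hom (fobj x) (fobj y);
  fhom1 : forall x, fhom (cid_ x) = cid_ (fobj x);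
  fhomM : forall x y z (g : hom y z) (f : hom x y),
    fhom (ccomp g f) = ccomp (fhom g) (fhom f)
}.
Arguments fobj {C D} _ _.
Arguments fhom {C D} _ {x y} _.

Definition functor_id (C : category) : functor C C :=
  @Functor C C (fun x => x) (fun x y f => f)
    (fun x => erefl) (fun x y z g f => erefl).

Lemma functor_comp1 (C D E : category) (G : functor D E) (F : functor C D) x :
  fhom G (fhom F (cid_ x)) = cid_ (fobj G (fobj F x)).
Proof. by rewrite !fhom1. Qed.

Lemma functor_compM (C D E : category) (G : functor D E) (F : functor C D)
    x y z (g : hom y z) (f : hom x y) :
  fhom G (fhom F (ccomp g f)) = ccomp (fhom G (fhom F g)) (fhom G (fhom F f)).
Proof. by rewrite !fhomM. Qed.

Definition functor_comp (C D E : category) (G : functor D E) (F : functor C D) :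
    functor C E :=
  @Functor C E (fun x => fobj G (fobj F x)) (fun x y f => fhom G (fhom F f))
    (functor_comp1 G F) (@functor_compM C D E G F).

Definition isomorphic_categories (C D : category) : Prop :=
  exists (F : functor C D) (G : functor D C),
    functor_comp G F = functor_id C /\ functor_comp F G = functor_id D.

Definition full_subcategory (C : category) (Q : obj C -> Prop) : category :=
  @Category {x : obj C | Q x} (fun x y => hom (sval x) (sval y))
    (fun x => cid_ (sval x)) (fun x y z g f => ccomp g f)
    (fun x y f => ccomp1l f) (fun x y f => ccomp1r f)
    (fun x y z t h g f => ccompA h g f).

Lemma linear_ext (R : pzRingType) (M N : lmodType R) (f g : {linear M -> N}) :
  f =1 g -> f = g.
Proof.
case: f => [f [[f1] [f2]]]; case: g => [g [[g1] [g2]]] /= /funext fg.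
case: _ / fg in g1 g2 *.
by rewrite (Prop_irrelevance f1 g1) (Prop_irrelevance f2 g2).
Qed.

Section ModuleCategory.
Variable R : pzRingType.

Definition linear_id (M : lmodType R) : {linear M -> M} := idfun.
Definition linear_comp (M N K : lmodType R) (g : {linear N -> K})
  (f : {linear M -> N}) : {linear M -> K} := g \o f.

Lemma linear_comp1l (M N : lmodType R) (f : {linear M -> N}) :
  linear_comp (linear_id N) f = f.
Proof. exact: linear_ext. Qed.
Lemma linear_comp1r (M N : lmodType R) (f : {linear M -> N}) :
  linear_comp f (linear_id M) = f.
Proof. exact: linear_ext. Qed.
Lemma linear_compA (M N K L : lmodType R) (h : {linear K -> L})
    (g : {linear N -> K}) (f : {linear M -> N}) :
  linear_comp h (linear_comp g f) = linear_comp (linear_comp h g) f.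
Proof. exact: linear_ext. Qed.

Definition Mod : category :=
  @Category (lmodType R) (fun M N => {linear M -> N}) linear_id linear_comp
    linear_comp1l linear_comp1r linear_compA.
End ModuleCategory.

Section OperatedModuleCategory.
Variables (k : comPzRingType) (Omega : Type) (A : com_operated_algebra k Omega).
Local Notation omod := (operated_module A).

Definition operated_id (M : omod) : operated_hom M M :=
  exist (@commutes_with_ops k Omega A M M) (linear_id M) (fun o m => erefl).

Lemma operated_comp_proof (M N K : omod) (g : operated_hom N K)
    (f : operated_hom M N) : commutes_with_ops (linear_comp (sval g) (sval f)).
Proof. by move=> o m; rewrite /= (svalP f) (svalP g). Qed.

Definition operated_comp (M N K : omod) (g : operated_hom N K)
    (f : operated_hom M N) : operated_hom M K :=
  exist _ (linear_comp (sval g) (sval f)) (operated_comp_proof g f).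

Lemma operated_ext (M N : omod) (f g : operated_hom M N) :
  sval f = sval g -> f = g.
Proof. by case: f g => [f fP] [g gP] /= fg; apply: eq_exist. Qed.

Lemma operated_comp1l (M N : omod) (f : operated_hom M N) :
  operated_comp (operated_id N) f = f.
Proof. exact/operated_ext/linear_comp1l. Qed.
Lemma operated_comp1r (M N : omod) (f : operated_hom M N) :
  operated_comp f (operated_id M) = f.
Proof. exact/operated_ext/linear_comp1r. Qed.
Lemma operated_compA (M N K L : omod) (h : operated_hom K L)
    (g : operated_hom N K) (f : operated_hom M N) :
  operated_comp h (operated_comp g f) = operated_comp (operated_comp h g) f.
Proof. exact/operated_ext/linear_compA. Qed.

Definition OperatedMod : category :=
  @Category omod (@operated_hom k Omega A) operated_id operated_comp
    operated_comp1l operated_comp1r operated_compA.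

(* Mod_A(Omega|E), for the set S of standard laws for E. *)
Definition EMod (S : set (law k Omega)) : category :=
  @full_subcategory OperatedMod (E_module S).
End OperatedModuleCategory.

(* Main.v *)
Require Import Defs.
From HB Require Import structures.
From mathcomp Require Import all_boot all_order all_algebra.
From mathcomp Require Import boolp classical_sets.
From Stdlib Require Import JMeq.

(** By the universal property of the free product, an operated module over A is
    the same thing as a left module over the ring A[Omega]: an element a of A
    acts by scaling and a symbol omega acts by the operator p_omega. For a
    two-sided ideal I of A[Omega], a left module over A[Omega]/I is the same
    thing as a left module over A[Omega] on which every element of I acts as
    zero. E-modules are the operated modules on which the ideal [E] acts as zero,
    so the proposition is the case I = [E] of [isomorphic_quotient].

    Two facts carry the argument. An operated module killed by I has a
    well-defined action of classes modulo I ([quo_scaleE]); and on the operated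
    module obtained from a module N over A[Omega]/I, the action of A[Omega]
    provided by the universal property is the action through the quotient map
    ([op_action_quo]). The latter, and the fact that a morphism of operated
    modules is linear over all of A[Omega] ([op_action_hom]), follow from
    [free_operators_ind]: A[Omega] is generated, under sums and products, by A
    and the symbols.

    An isomorphism of categories asks for equalities of objects, not isomorphisms.
    Both functors keep the underlying abelian group and the underlying map of a
    morphism, and the first part of the file turns this into equalities of
    modules and of functors. As going back and forth changes the type of a
    morphism by an equality of modules that does not hold by computation,
    morphisms are compared by heterogeneous equality. *)

Set Implicit Arguments.
Unset Strict Implicit.
Unset Printing Implicit Defensive.

Import GRing.Theory.
Local Open Scope ring_scope.

(** * Equality of modules, linear maps and functors *)

Lemma eq_JMeq (T : Type) (x y : T) : x = y -> JMeq x y.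
Proof. by move=> ->. Qed.

(** A module is split into its group and its scaling, so that an equality of
    groups can be eliminated before the scalings are compared. *)
Definition scaling (R : pzRingType) (V : zmodType) : Type :=
  GRing.Nmodule_isLSemiModule R V.

Definition scale_by (R : pzRingType) (V : zmodType) (s : scaling R V) :
    R -> V -> V := GRing.Nmodule_isLSemiModule.scale s.

Definition lmodule_on (R : pzRingType) (V : zmodType) (s : scaling R V) :
    lmodType R := HB.pack V (s : GRing.Nmodule_isLSemiModule R V).

Definition scaling_of (R : pzRingType) (M : lmodType R) : scaling R M :=
  GRing.Lmodule.class M.

Lemma lmodule_onK (R : pzRingType) (M : lmodType R) :
  lmodule_on (scaling_of M) = M.
Proof. by case: M. Qed.

Lemma scaling_ext (R : pzRingType) (V : zmodType) (s t : scaling R V) :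
  scale_by s =2 scale_by t -> s = t.
Proof.
case: s t => [s s1 s2 s3 s4 s5] [t t1 t2 t3 t4 t5]; rewrite /scale_by /= => st.
have {}st : s = t by apply/funext => a; apply/funext => m.
case: _ / st in t1 t2 t3 t4 t5 *.
congr GRing.Nmodule_isLSemiModule.Axioms_; exact: Prop_irrelevance.
Qed.

Lemma lmodule_on_eq (R : pzRingType) (V W : zmodType)
    (s : scaling R V) (t : scaling R W) :
  V = W ->
  (forall a v w, JMeq v w -> JMeq (scale_by s a v) (scale_by t a w)) ->
  lmodule_on s = lmodule_on t.
Proof.
move=> VW; case: _ / VW in t * => st.
by congr lmodule_on; apply: scaling_ext => a v; apply/JMeq_eq/st.
Qed.

(** The first premise includes the equality and choice structures of the
    carriers, so it is meant for modules built on one and the same group. *)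
Lemma lmodule_eq (R : pzRingType) (M N : lmodType R) :
  (M : zmodType) = (N : zmodType) ->
  (forall a (m : M) (n : N), JMeq m n -> JMeq (a *: m) (a *: n)) -> M = N.
Proof.
move=> MN st; rewrite -(lmodule_onK M) -(lmodule_onK N).
exact: lmodule_on_eq.
Qed.

Lemma linear_JMeq (R : pzRingType) (M M' N N' : lmodType R)
    (f : {linear M -> N}) (f' : {linear M' -> N'}) :
  M = M' -> N = N' ->
  (forall (m : M) (m' : M'), JMeq m m' -> JMeq (f m) (f' m')) -> JMeq f f'.
Proof.
move=> eM eN; case: _ / eM in f' *; case: _ / eN in f' * => ff'.
by apply/eq_JMeq/linear_ext => m; apply/JMeq_eq/ff'.
Qed.

Lemma functor_eq (C D : category) (F G : functor C D) :
  (forall x, fobj F x = fobj G x) ->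
  (forall x y (f : Defs.hom x y), JMeq (fhom F f) (fhom G f)) -> F = G.
Proof.
case: F G => [Fo Fh F1 FM] [Go Gh G1 GM] /= /funext FG.
case: _ / FG in Gh G1 GM * => FGh.
have FG : Fh = Gh.
  apply: functional_extensionality_dep => x.
  apply: functional_extensionality_dep => y.
  by apply: funext => f; apply/JMeq_eq.
case: _ / FG in G1 GM *.
by rewrite (Prop_irrelevance F1 G1) (Prop_irrelevance FM GM).
Qed.

(** * Operated modules and the ring of free operators *)

Section FreeOperators.
Variables (k : comPzRingType) (Omega : Type) (A : com_operated_algebra k Omega).
Local Notation AO := (free_operators A).

(** Constants from k need no case of their own, because they lie in A. *)
Lemma free_operators_ind (Q : AO -> Prop) :
  (forall a, Q (op_of_alg a)) -> (forall o, Q (op_of_sym A o)) ->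
  (forall L L', Q L -> Q L' -> Q (L + L')) ->
  (forall L L', Q L -> Q L' -> Q (L * L')) ->
  forall L, Q L.
Proof.
move=> Qa Qo QD QM.
have [_ _ lc] := op_of_alg_morphism A.
have [[_ rD] [_ rM] rc] := fp_inr_morphism (oa_alg A) (free_alg k Omega).
elim/pres_ind; elim=> [[a|b]|c|s Qs t Qt|s Qs t Qt].
- exact: Qa.
- (* The generators of a free product contain all of k<Omega>, whose elements
     are classes of terms in turn. *)
  elim/pres_ind: b; elim=> [o|c|s Qs t Qt|s Qs t Qt].
  + exact: Qo.
  + by have := Qa (alg_str (oa_alg A) c); rewrite lc -rc.
  + by rewrite -pres_addE; have := QD _ _ Qs Qt; rewrite -rD.
  + by rewrite -pres_mulE; have := QM _ _ Qs Qt; rewrite -rM.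
- by have := Qa (alg_str (oa_alg A) c); rewrite lc.
- by rewrite -pres_addE; apply: QD.
- by rewrite -pres_mulE; apply: QM.
Qed.

Lemma op_action_hom (M N : operated_module A) (phi : operated_hom M N) L m :
  sval phi (op_action L m) = op_action L (sval phi m).
Proof.
have [_ actM actD _] := op_action_module M.
have [_ actM' actD' _] := op_action_module N.
elim/free_operators_ind: L m => [a|o|L L' IH IH'|L L' IH IH'] m.
- by rewrite !op_action_alg linearZ.
- by rewrite !op_action_sym (svalP phi).
- by rewrite actD actD' linearD IH IH'.
- by rewrite actM actM' IH IH'.
Qed.

Lemma operated_module_eq (M N : operated_module A) :
  (M : lmodType A) = (N : lmodType A) ->
  (forall o (m : M) (n : N), JMeq m n -> JMeq (om_op M o m) (om_op N o n)) ->
  M = N.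
Proof.
case: M N => [M p] [N q] /= MN; case: _ / MN in q * => pq.
congr OperatedModule; apply: functional_extensionality_dep => o.
by apply: linear_ext => m; apply/JMeq_eq/pq.
Qed.

Lemma operated_hom_JMeq (M M' N N' : operated_module A)
    (f : operated_hom M N) (f' : operated_hom M' N') :
  M = M' -> N = N' ->
  (forall (m : M) (m' : M'), JMeq m m' -> JMeq (sval f m) (sval f' m')) ->
  JMeq f f'.
Proof.
move=> eM eN; case: _ / eM in f' *; case: _ / eN in f' * => ff'.
by apply/eq_JMeq/operated_ext/linear_ext => m; apply/JMeq_eq/ff'.
Qed.

Section Ideal.
Variable I : ideal AO.
Local Notation Q := (quotient_ring I).

Definition killed_by (M : operated_module A) : Prop :=
  forall L, I L -> forall m : M, op_action L m = 0.

(** * From operated modules killed by an ideal to modules over the quotient *)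

Section ToQuotient.
Variables (M : operated_module A) (IM : killed_by M).

Lemma op_action_eqv L L' (m : M) :
  quo I L = quo I L' -> op_action L m = op_action L' m.
Proof.
have [_ _ actD _] := op_action_module M.
by move=> /quo_eqP/IM/(_ m) LL'; rewrite -[L](subrK L') actD LL' add0r.
Qed.

(** A copy of the carrier of M that records the proof IM, on which the module
    structure below depends. *)
Definition over_quotient : Type := let _ := IM in M.
HB.instance Definition _ := GRing.Zmodule.copy over_quotient M.

Definition quo_scale (q : Q) (m : over_quotient) : over_quotient :=
  op_action (repr q) (m : M).

Lemma quo_scaleE L m : quo_scale (quo I L) m = op_action L (m : M).
Proof. by apply: op_action_eqv; rewrite /quo reprK. Qed.

Lemma quo_scaleA a b m : quo_scale a (quo_scale b m) = quo_scale (a * b) m.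
Proof.
have [_ actM _ _] := op_action_module M.
elim/quo_ind: a => a; elim/quo_ind: b => b.
by rewrite -rmorphM !quo_scaleE actM.
Qed.

Lemma quo_scale1 : left_id 1 quo_scale.
Proof.
have [act1 _ _ _] := op_action_module M.
by move=> m; rewrite -(rmorph1 (quo I)) quo_scaleE act1.
Qed.

Lemma quo_scaleDr : right_distributive quo_scale +%R.
Proof.
have [_ _ _ actDr] := op_action_module M.
by move=> a m n; apply: actDr.
Qed.

Lemma quo_scaleDl m : {morph quo_scale^~ m : a b / a + b}.
Proof.
have [_ _ actD _] := op_action_module M.
elim/quo_ind=> a; elim/quo_ind=> b.
by rewrite -rmorphD !quo_scaleE actD.
Qed.

HB.instance Definition _ := GRing.Zmodule_isLmodule.Build Q over_quotient
  quo_scaleA quo_scale1 quo_scaleDr quo_scaleDl.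
End ToQuotient.

Section HomToQuotient.
Variables (M N : operated_module A) (IM : killed_by M) (IN : killed_by N).
Variable f : operated_hom M N.

Definition quo_hom (m : over_quotient IM) : over_quotient IN := sval f m.

Lemma quo_hom_is_linear : linear quo_hom.
Proof.
move=> q m n; rewrite /quo_hom (linearD (sval f)); congr (_ + _).
exact: op_action_hom.
Qed.
HB.instance Definition _ := GRing.isLinear.Build Q
  (over_quotient IM) (over_quotient IN) *:%R quo_hom quo_hom_is_linear.
End HomToQuotient.

(** * From modules over the quotient to operated modules *)

Definition quo_alg (a : A) : Q := quo I (op_of_alg a).

Lemma quo_alg_is_nmod_morphism : nmod_morphism quo_alg.
Proof.
have [[a0 aD] _ _] := op_of_alg_morphism A.
by split=> [|a b]; rewrite /quo_alg ?a0 ?aD ?rmorph0 ?rmorphD.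
Qed.

Lemma quo_alg_is_monoid_morphism : monoid_morphism quo_alg.
Proof.
have [_ [a1 aM] _] := op_of_alg_morphism A.
by split=> [|a b]; rewrite /quo_alg ?a1 ?aM ?rmorph1 ?rmorphM.
Qed.

HB.instance Definition _ := GRing.isNmodMorphism.Build A Q quo_alg
  quo_alg_is_nmod_morphism.
HB.instance Definition _ := GRing.isMonoidMorphism.Build A Q quo_alg
  quo_alg_is_monoid_morphism.

Section FromQuotient.
Variable N : lmodType Q.

Definition over_alg : lmodType A := restr quo_alg N.
Local Notation kN := (restr (oa_str A) over_alg).

Definition quo_op (o : Omega) (n : kN) : kN :=
  quo I (op_of_sym A o) *: (n : N).

(** The symbols act k-linearly because k is central in A[Omega]; they need not
    commute with A. *)
Lemma quo_op_is_linear o : linear (quo_op o).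
Proof.
have [_ _ strE] := op_of_alg_morphism A.
move=> c u v; rewrite /quo_op [LHS](@scalerDr Q N); congr (_ + _).
rewrite [LHS](@scalerA Q N) [RHS](@scalerA Q N).
apply: (congr1 (fun q : Q => q *: (u : N))).
rewrite -!(rmorphM (quo I)); congr quo.
by rewrite [op_of_alg _]strE alg_central.
Qed.
HB.instance Definition _ o :=
  GRing.isLinear.Build k kN kN *:%R (quo_op o) (quo_op_is_linear o).

Definition operated_of : operated_module A :=
  OperatedModule (om_mod := over_alg)
    (fun o => quo_op o : {linear kN -> kN}).

(** Both sides are actions of A[Omega] on N, and they agree on generators. *)
Lemma op_action_quo L (n : operated_of) : op_action L n = quo I L *: (n : N).
Proof.
have [_ actM actD _] := op_action_module operated_of.
elim/free_operators_ind: L n => [a|o|L L' IH IH'|L L' IH IH'] n.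
- by rewrite op_action_alg.
- by rewrite op_action_sym.
- by rewrite actD IH IH' rmorphD [RHS](@scalerDl Q N).
- by rewrite actM IH IH' rmorphM [LHS](@scalerA Q N).
Qed.

Lemma operated_of_killed : killed_by operated_of.
Proof.
move=> L IL n; rewrite op_action_quo.
have -> : quo I L = 0.
  by rewrite -(rmorph0 (quo I)); apply/quo_eqP; rewrite subr0.
exact: (@scale0r Q N).
Qed.
End FromQuotient.

Section HomFromQuotient.
Variables (M N : lmodType Q) (f : {linear M -> N}).

Definition over_alg_hom (m : over_alg M) : over_alg N := f m.

Lemma over_alg_hom_is_linear : linear over_alg_hom.
Proof. by move=> a m n; apply: (linearP f). Qed.
HB.instance Definition _ := GRing.isLinear.Build A (over_alg M) (over_alg N)
  *:%R over_alg_hom over_alg_hom_is_linear.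

Lemma over_alg_hom_commutes :
  @commutes_with_ops k Omega A (operated_of M) (operated_of N) over_alg_hom.
Proof. by move=> o m; apply: (linearZZ f). Qed.

Definition operated_hom_of : operated_hom (operated_of M) (operated_of N) :=
  exist (@commutes_with_ops k Omega A (operated_of M) (operated_of N)) _
    over_alg_hom_commutes.
End HomFromQuotient.

(** * The isomorphism of categories *)

Definition KilledMod : category := @full_subcategory (OperatedMod A) killed_by.

Definition to_quotient : functor KilledMod (Mod Q).
Proof.
apply: (@Functor KilledMod (Mod Q) (fun M => over_quotient (svalP M))
  (fun M N (f : Defs.hom M N) => @quo_hom _ _ (svalP M) (svalP N) f
     : {linear over_quotient (svalP M) -> over_quotient (svalP N)})).
- by move=> M; apply: linear_ext.
- by move=> M N K g f; apply: linear_ext.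
Defined.

Definition from_quotient : functor (Mod Q) KilledMod.
Proof.
apply: (@Functor (Mod Q) KilledMod
  (fun M => exist killed_by (operated_of M) (@operated_of_killed M))
  (fun M N f => operated_hom_of f)).
- by move=> M; apply/operated_ext/linear_ext.
- by move=> M N K g f; apply/operated_ext/linear_ext.
Defined.

Lemma operated_of_over_quotient (M : operated_module A) (IM : killed_by M) :
  operated_of (over_quotient IM) = M.
Proof.
(* The two carriers are convertible, but typed through different modules: the
   ascription brings both elements to the carrier of M. *)
apply: operated_module_eq => [|o m n mn].
  apply: lmodule_eq => [|a m n mn]; first by [].
  have <- : (m : M) = n := JMeq_eq mn; apply: (@eq_JMeq M).
  exact: etrans (@quo_scaleE M IM (op_of_alg a) m) (op_action_alg a (m : M)).
have <- : (m : M) = n := JMeq_eq mn; apply: (@eq_JMeq M).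
exact: etrans (@quo_scaleE M IM (op_of_sym A o) m) (op_action_sym o (m : M)).
Qed.

(** The proof IN is arbitrary, since the one that a functor supplies need not
    reduce to [operated_of_killed]. *)
Lemma over_quotient_operated_of (N : lmodType Q)
    (IN : killed_by (operated_of N)) : (over_quotient IN : lmodType Q) = N.
Proof.
apply: lmodule_eq => [|q m n mn]; first by [].
have <- : (m : N) = n := JMeq_eq mn; apply: (@eq_JMeq N).
by elim/quo_ind: q => L; rewrite [LHS]quo_scaleE op_action_quo.
Qed.

(** Objects are restored by the two preceding lemmas, and morphisms because both
    functors leave the underlying maps as they are. *)
Theorem isomorphic_quotient : isomorphic_categories KilledMod (Mod Q).
Proof.
exists to_quotient, from_quotient; split.
- have objK (M : obj KilledMod) : fobj from_quotient (fobj to_quotient M) = M.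
    by case: M => M IM; apply: eq_exist; apply: operated_of_over_quotient.
  apply: functor_eq => // M N f.
  apply: operated_hom_JMeq => [||m m' mm'].
  + exact: (congr1 sval (objK M)).
  + exact: (congr1 sval (objK N)).
  + by have <- : (m : sval M) = m' := JMeq_eq mm'.
- have objK (M : obj (Mod Q)) : fobj to_quotient (fobj from_quotient M) = M.
    exact: over_quotient_operated_of.
  apply: functor_eq => // M N f.
  apply: linear_JMeq => [||m m' mm']; [exact: objK | exact: objK|].
  by have <- : (m : (M : lmodType Q)) = m' := JMeq_eq mm'.
Qed.
End Ideal.
End FreeOperators.

Theorem proposition3p6 (k : comPzRingType) (Omega : Type)
    (A : com_operated_algebra k Omega) (E S : set (law k Omega))
    (hE : submodule E) (hS : standard_laws E S) (hA : E_algebra A E) :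
  isomorphic_categories (EMod A S) (Mod (E_operators A S)).
Proof. exact: isomorphic_quotient. Qed.
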